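(* Let $X$ be an infinite-dimensional separable Banach space of analytic functions on $\mathbb{D}$ such that: (1) $H^\infty$ is dense in $X$ (in particular $H^\infty\subset X$); and (2) for every analytic self-map $\psi:\mathbb{D}\to\mathbb{D}$ and every $u\in H^\infty$, the weighted composition operator $C_{u,\psi}$ is a bounded operator on $X$ and $\|(C_{u,\psi})^n f\|_X\le \|u^{(n)}\|_X\,\|f\|_\infty$ for all $f\in H^\infty$ and all $n\in\mathbb{N}$. Let $\varphi:\mathbb{D}\to\mathbb{D}$ be an analytic self-map and $w\in H^\infty$. Then $C_{w,\varphi}$ is densely mean Li--Yorke chaotic on $X$ if there is an increasing sequence $(N_k)_{k\in\mathbb{N}}$ of positive integers such that $$\lim_{k\to\infty}\frac1{N_k}\sum_{j=1}^{N_k}\|w^{(j)}\|_X=0\quad\text{and}\quad\sup_{N\in\mathbb{N}}\frac1N\sum_{j=1}^N\|w^{(j)}\|_X=\infty.$$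
   Context: $\mathbb{D}$ is the open unit disk in $\mathbb{C}$, $\mathbb{N}=\{1,2,\dots\}$. $H^\infty$ is the space of bounded analytic functions on $\mathbb{D}$ with $\|f\|_\infty=\sup_{z\in\mathbb{D}}|f(z)|$. For an analytic self-map $\varphi$ of $\mathbb{D}$ and $w\in H^\infty$, the weighted composition operator is $C_{w,\varphi}f=w\cdot(f\circ\varphi)$; $\varphi^n$ denotes the $n$-fold iterate of $\varphi$; and $w^{(1)}=w$, $w^{(n)}=(w\circ\varphi^{n-1})\cdots(w\circ\varphi)\cdot w$ for $n\ge2$ (so $w^{(n)}$ depends on $\varphi$ too; $u^{(n)}$ is formed with $\psi$ in the same way), so that $(C_{w,\varphi})^nf=w^{(n)}\cdot(f\circ\varphi^n)$. A bounded operator $T$ on a Banach space $X$ is densely mean Li--Yorke chaotic if there is an uncountable dense set $S\subset X$ such that for all distinct $x,y\in S$, $\liminf_{N\to\infty}\frac1N\sum_{j=1}^N\|T^jx-T^jy\|=0$ and $\limsup_{N\to\infty}\frac1N\sum_{j=1}^N\|T^jx-T^jy\|>0$. *)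

(* Defs.v *)
(* The complex numbers are R[i], for R : realType. *)
From HB Require Import structures.
From mathcomp Require Export all_boot all_order all_algebra.
From mathcomp Require Export complex.
From mathcomp Require Export all_classical all_reals all_analysis.
Export Order.TTheory GRing.Theory Num.Theory.
Export numFieldNormedType.Exports.

Set Implicit Arguments.
Unset Strict Implicit.
Unset Printing Implicit Defensive.

Local Open Scope classical_set_scope.
Local Open Scope ring_scope.

Section Disk.
Variable R : realType.

(* A function on the unit disk is represented by a total function of which
   only the values on the disk matter. The regular-module tag ^o gives access
   to the normed module structure of R[i] over itself, so that [derivable f z 1]
   below is complex differentiability at z. *)
Local Notation C := (R[i]^o).

Definition unit_disk : set C := [set z | `|z| < 1].

Definition eq_on_disk (f g : C -> C) : Prop :=
  forall z, unit_disk z -> f z = g z.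

Definition analytic (f : C -> C) : Prop :=
  forall z, unit_disk z -> derivable f z 1.

Definition analytic_self_map (psi : C -> C) : Prop :=
  analytic psi /\ (forall z, unit_disk z -> unit_disk (psi z)).

Definition Hinfty (f : C -> C) : Prop :=
  analytic f /\ [bounded f z | z in unit_disk].

(* Norms of complex normed spaces take their (real) values in R[i]; they are
   brought back to R by the real part. *)
Definition Hinfty_norm (f : C -> C) : R :=
  sup [set complex.Re `|f z| | z in unit_disk].

(* u^(n) = (u o psi^(n-1)) ... (u o psi) u *)
Definition weight_iter (u psi : C -> C) (n : nat) : C -> C :=
  fun z => \prod_(0 <= k < n) u (iter k psi z).

Definition wcomp (u psi f : C -> C) : C -> C := fun z => u z * f (psi z).

(* (1/N) (a_1 + ... + a_N); the junk value at N = 0 is 0. *)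
Definition cesaro (a : nat -> R) (N : nat) : R :=
  N%:R^-1 * \sum_(1 <= j < N.+1) a j.

End Disk.

Section Banach.
Variables (R : realType) (X : completeNormedModType R[i]).

Definition rnorm (x : X) : R := complex.Re `|x|.

Definition separable : Prop := exists A : set X, countable A /\ dense A.

Definition infinite_dimensional : Prop :=
  forall (n : nat) (v : 'I_n -> X),
    exists x, forall c : 'I_n -> R[i], x <> \sum_(i < n) c i *: v i.

Definition bounded_operator (T : X -> X) : Prop :=
  linear T /\ exists M : R, forall x, rnorm (T x) <= M * rnorm x.

Definition densely_mean_Li_Yorke_chaotic (T : X -> X) : Prop :=
  bounded_operator T /\
  exists S : set X, [/\ ~ countable S, dense S &
    forall x y, S x -> S y -> x <> y ->
      let m := cesaro (fun j => rnorm (iter j T x - iter j T y)) in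
      limn_einf (fun N => (m N)%:E) = 0%E /\
      (0 < limn_esup (fun N => (m N)%:E))%E].

End Banach.

Section FunctionSpace.
Variables (R : realType) (X : completeNormedModType R[i]).
Local Notation C := (R[i]^o).

(* A Banach space of analytic functions on the disk is a Banach space X
   together with the map fn sending an element of X to the function it is;
   the vector space operations are pointwise and an element is determined by
   its values on the disk. *)
Record analytic_function_space (fn : X -> C -> C) : Prop :=
  AnalyticFunctionSpace {
    fn_analytic : forall x, analytic (fn x);
    fn_linear : forall (a : R[i]) x y,
      eq_on_disk (fn (a *: x + y)) (fun z => a * fn x z + fn y z);
    fn_inj : forall x y, eq_on_disk (fn x) (fn y) -> x = y }.

Variable fn : X -> C -> C.

Definition in_space (f : C -> C) : Prop := exists x, eq_on_disk (fn x) f.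

(* The element of X which is the function f; meaningful when in_space f. *)
Definition elt (f : C -> C) : X := xget 0 [set x | eq_on_disk (fn x) f].

Definition space_norm (f : C -> C) : R := rnorm (elt f).

Definition wcomp_op (u psi : C -> C) : X -> X :=
  fun x => elt (wcomp u psi (fn x)).

(* wcomp_op is meaningful only if X is mapped into itself, whence the first
   conjunct. *)
Definition wcomp_bounded (u psi : C -> C) : Prop :=
  (forall x, in_space (wcomp u psi (fn x))) /\
  bounded_operator (wcomp_op u psi).

End FunctionSpace.

(* Main.v *)
(* Put m_N(x) = (1/N) sum_(1 <= j <= N) ||T^j x||. The points x with
   liminf m_N(x) = 0 contain a dense G_delta, since m_(N_k)(f) <= ||f||_oo *
   (mean of ||w^(j)||) -> 0 on the dense set of bounded f; the points with
   limsup m_N(x) >= 1 contain another one, since T^j 1 = w^(j) has unbounded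
   means and x can be perturbed by a small multiple of 1. Hence so does the set G
   of points with both properties, and G = -G. By Baire's theorem, countably
   many translates of G always meet in every open set: this gives a countable
   dense set with all differences in G, and shows that a maximal set with this
   property extending it (Zorn) is uncountable. *)
Require Import Defs.
From mathcomp Require Import lra.

Set Implicit Arguments.
Unset Strict Implicit.
Unset Printing Implicit Defensive.

Local Open Scope classical_set_scope.
Local Open Scope ring_scope.

(** * Real-valued norm and the topology it induces *)

Section RealNorm.
Variables (R : realType) (X : completeNormedModType R[i]).
Implicit Types (x y : X) (A : set X).

(** In the order of [R[i]], a nonnegative element has zero imaginary part. *)
Lemma normrE x : `|x| = (rnorm x)%:C%C.
Proof.
have := normr_ge0 x; rewrite lecE /rnorm; case: `|x| => a b /= /andP[/eqP b0 _].
by rewrite b0.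
Qed.

Lemma rnorm_ge0 x : 0 <= rnorm x.
Proof. by have := normr_ge0 x; rewrite normrE lecR. Qed.

Lemma rnormD x y : rnorm (x + y) <= rnorm x + rnorm y.
Proof. by have := ler_normD x y; rewrite !normrE -rmorphD lecR. Qed.

Lemma rnorm0 : rnorm (0 : X) = 0.
Proof. by rewrite /rnorm normr0. Qed.

Lemma rnormN x : rnorm (- x) = rnorm x.
Proof. by rewrite /rnorm normrN. Qed.

Lemma rnormZ (a : R) x : 0 <= a -> rnorm (a%:C%C *: x) = a * rnorm x.
Proof.
move=> a0; apply: (@complexI R); rewrite -normrE normrZ normrE rmorphM /=.
by rewrite ger0_norm // lecR.
Qed.

Lemma nbhs_rnormP x A :
  nbhs x A <-> exists2 r : R, 0 < r & forall y, rnorm (y - x) < r -> A y.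
Proof.
rewrite nbhs_ballP; split=> [[e /= e0 eA]|[r r0 rA]].
  move: e0 eA; rewrite ltcE; case: e => a b /= /andP[/eqP -> a0] eA.
  exists a => // y ya; apply: eA; rewrite -ball_normE /= distrC normrE.
  by rewrite ltcR.
exists r%:C%C => /=; first by rewrite ltcR.
move=> y; rewrite -ball_normE /= distrC normrE ltcR; exact: rA.
Qed.

Lemma cvg_rnormP (u : nat -> X) l :
  (u n @[n --> \oo] --> l) <->
  forall r : R, 0 < r -> \forall n \near \oo, rnorm (u n - l) < r.
Proof.
split=> [ul r r0|ul A /nbhs_rnormP[r r0 rA]].
  by apply: (ul [set y | rnorm (y - l) < r]); apply/nbhs_rnormP; exists r.
by apply: filterS (ul r r0) => n; exact: rA.
Qed.

Lemma open_rball x (r : R) : open [set y | rnorm (y - x) < r].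
Proof.
rewrite openE => y /= yr; apply/nbhs_rnormP; exists (r - rnorm (y - x)).
  by rewrite subr_gt0.
move=> z zr; rewrite /= -(subrK y z) -addrA (le_lt_trans (rnormD _ _))//.
by rewrite -ltrBrDr.
Qed.

Lemma open_rnormP A x : open A -> A x ->
  exists2 r : R, 0 < r & forall y, rnorm (y - x) < r -> A y.
Proof. by move=> oA Ax; apply/nbhs_rnormP/open_nbhs_nbhs. Qed.

End RealNorm.

(* The library's Baire theorem is restricted to real scalars. *)
Section Baire.
Variables (R : realType) (X : completeNormedModType R[i]).

(** Nested closed balls [cb (c n)], with radii at most 1/n for n > 0, are chosen inside the
    successive [F n]; their centres form a Cauchy sequence, whose limit lies in all of them. *)
Lemma baire_complex (F : nat -> set X) :
  (forall n, open (F n) /\ dense (F n)) -> dense (\bigcap_n F n).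
Proof.
move=> odF D [d0 Dd0] oD.
pose cb (c : X * R) := [set y | rnorm (y - c.1) <= c.2].
(* Positivity of the radius is a premise inside the existential, so that [choice] yields a total
   function. *)
have step n (c : X * R) : exists c' : X * R, 0 < c.2 ->
    [/\ 0 < c'.2, c'.2 <= n.+1%:R^-1 & cb c' `<=` cb c `&` F n].
  have [c0|] := ltP 0 c.2; last by move=> c0; exists c; rewrite ltNge c0.
  have [oFn dFn] := odF n.
  have [|y [yc Fy]] := dFn [set y | rnorm (y - c.1) < c.2] _ (@open_rball _ _ _ _).
    by exists c.1; rewrite /= subrr rnorm0.
  have [r r0 rF] := open_rnormP (openI (@open_rball _ _ c.1 c.2) oFn) (conj yc Fy).
  (* Halving [r] puts the closed ball inside the open ball of radius [r]; the minimum forces the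
     radii to 0. *)
  exists (y, Num.min (r / 2) n.+1%:R^-1); split => //=.
  - by rewrite lt_min divr_gt0//= invr_gt0.
  - by rewrite ge_min lexx orbT.
  - move=> z /=; rewrite /cb /= => zy.
    have [|/ltW zc Fz] := rF z; last by split.
    rewrite (le_lt_trans zy)// gt_min; apply/orP; left.
    by rewrite ltr_pdivrMr// ltr_pMr// ltr1n.
have [f fP] := choice (fun nc : nat * (X * R) => step nc.1 nc.2).
have [r0 r00 r0D] := open_rnormP oD Dd0.
pose c := fix c n := if n is m.+1 then f (m, c m) else (d0, r0 / 2).
have c0 n : 0 < (c n).2.
  elim: n => [|n IHn]; first by rewrite /= divr_gt0.
  by have [] := fP (n, c n) IHn.
have cS n : (c n.+1).2 <= n.+1%:R^-1 /\ cb (c n.+1) `<=` cb (c n) `&` F n.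
  by have [] := fP (n, c n) (c0 n).
have cxx n : cb (c n) (c n).1 by rewrite /cb /= subrr rnorm0 ltW.
have cmono n k : cb (c (n + k)%N) `<=` cb (c n).
  elim: k => [|k IHk]; first by rewrite addn0.
  by rewrite addnS => y /(cS _).2[/IHk].
pose u n := (c n).1.
have ucb n m : (n <= m)%N -> rnorm (u m - u n) <= (c n).2.
  by move=> nm; have := cmono n (m - n)%N (u m); rewrite subnKC//; apply; apply: cxx.
have /cvg_ex[l /= ul] : cvg (u @ \oo).
  apply: cauchy_cvg; apply: cauchy_exP => e /=; rewrite ltcE; case: e => e b /=.
  move=> /andP[/eqP -> e0].
  have [n ne] : exists n, n.+1%:R^-1 < e.
    exists (Num.truncn e^-1).
    by rewrite invf_plt ?posrE// truncnS_gt.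
  exists (u n.+1); exists n.+1 => // m /= nm.
  rewrite -ball_normE /= distrC normrE ltcR.
  by rewrite (le_lt_trans (ucb _ _ nm))// (le_lt_trans (cS n).1).
have lcb n : cb (c n) l.
  apply/ler_addgt0Pr => e e0.
  have /cvg_rnormP/(_ e e0)[N _ NP] := ul.
  have := NP (maxn n N) (leq_maxr _ _); set m := maxn n N => lm.
  rewrite -(subrK (u m) l) -addrA addrC.
  rewrite (le_trans (rnormD _ _))// lerD ?ucb ?leq_maxl//.
  by rewrite -rnormN opprB ltW.
exists l; split.
  apply: r0D; rewrite (le_lt_trans (lcb 0%N))//=.
  by rewrite ltr_pdivrMr// ltr_pMr// ltr1n.
by move=> n _; have [] := (cS n).2 l (lcb n.+1).
Qed.

End Baire.

(** * Sets whose nonzero differences all lie in a dense G_delta *)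

Section DifferenceSet.
Variables (R : realType) (X : completeNormedModType R[i]).

(** Inclusion in the range, not equality, also covers the empty set; integers without a preimage are
    sent to 0. *)
Lemma countable_enum (E : set X) :
  countable E -> exists e : nat -> X, E `<=` range e.
Proof.
move=> /countable_injP[f finj].
exists (fun n => xget 0 [set x | E x /\ f x = n]) => x Ex; exists (f x) => //.
case: xgetP => [y _ [Ey fyx]|/(_ x)]; last by case.
by apply: finj => //; apply/mem_set.
Qed.

Variable F : nat -> set X.
Hypotheses (F_open : forall n, open (F n)) (F_dense : forall n, dense (F n)).
Hypothesis F_opp : forall n x, F n x -> F n (- x).

Let G := \bigcap_n F n.
Hypothesis G0 : ~ G 0.

Let G_sym x y : G (x - y) -> G (y - x).
Proof. by move=> Gxy n _; rewrite -opprB; apply: F_opp; apply: Gxy. Qed.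

Lemma open_shift (U : set X) (a : X) : open U -> open [set x | U (x - a)].
Proof.
move=> oU; rewrite openE => x /= /(open_rnormP oU)[r r0 rU].
apply/nbhs_rnormP; exists r => // y yr /=.
by apply: rU; rewrite opprD opprK addrACA addNr addr0.
Qed.

Lemma dense_shift (U : set X) (a : X) : dense U -> dense [set x | U (x - a)].
Proof.
move=> dU V [v Vv] oV.
have [||y [Vy Uy]] := dU [set x | V (x - (- a))].
- by exists (v - a); rewrite /= opprK subrK.
- exact: open_shift.
- by exists (y + a); split => /=; [rewrite -[a]opprK|rewrite addrK].
Qed.

(** The conditions [F k (x - e)], for [e] in [E] and all [k], are countably many open dense ones, so
    Baire's theorem applies. *)
Lemma generic_avoiding (E U : set X) : countable E -> open U -> U !=set0 ->
  exists2 x, U x & forall e, E e -> G (x - e).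
Proof.
move=> /countable_enum[e Ee] oU U0.
(* One integer encodes the pair [(i, k)]; integers encoding no pair impose no condition. *)
pose H (p : nat) := if unpickle p is Some (i, k)
                    then [set x | F k (x - e i)] else setT.
have [|x [Ux Hx]] := @baire_complex _ _ H _ U U0 oU.
  move=> p; rewrite /H; case: unpickle => [[i k]|]; last first.
    by split; [exact: openT|move=> V [v Vv] _; exists v].
  by split; [exact: open_shift|exact: dense_shift].
exists x => // y /Ee[i _ <-] k _.
by have := Hx (pickle (i, k)) I; rewrite /H pickleK.
Qed.

Definition scattered (S : set X) :=
  forall x y, S x -> S y -> x <> y -> G (x - y).

(** Points are chosen recursively, one in each ball of radius 1/(k+1) about [a i], each generic with
    respect to the finitely many chosen before. *)
Lemma dense_scattered : separable X -> exists2 S : set X, dense S & scattered S.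
Proof.
case=> A [/countable_enum[a Aa] dA].
have step (pL : nat * seq X) : exists x,
    (if unpickle pL.1 is Some (i, k) then rnorm (x - a i) < k.+1%:R^-1
     else True) /\ (forall e, e \in pL.2 -> G (x - e)).
  case: pL => p L /=; pose U := if unpickle p is Some (i, k) then
    [set x | rnorm (x - a i) < k.+1%:R^-1] else setT.
  have [| | |x Ux xL] := @generic_avoiding [set` L] U.
  - exact/finite_set_countable/finite_seq.
  - by rewrite /U; case: unpickle => [[i k]|]; [exact: open_rball|exact: openT].
  - rewrite /U; case: unpickle => [[i k]|]; last by exists 0.
    by exists (a i); rewrite /= subrr rnorm0 invr_gt0.
  by exists x; split => //; move: Ux; rewrite /U; case: unpickle => [[]|].
have [f fP] := choice step.
(* [L n] lists the points chosen before stage [n], the latest first. *)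
pose L := fix L n := if n is m.+1 then f (m, L m) :: L m else [::].
have Lmono m n x : (m <= n)%N -> x \in L m -> x \in L n.
  move=> /subnKC <-; elim: (n - m)%N => [|k IHk]; first by rewrite addn0.
  by move=> /IHk; rewrite addnS /= inE orbC => ->.
have LG n : scattered [set` L n].
  elim: n => [|n IHn] x y //=; rewrite !inE.
  move=> /predU1P[->|xL] /predU1P[->|yL] xy //.
  - exact: (fP (n, L n)).2.
  - by apply: G_sym; exact: (fP (n, L n)).2.
  - exact: IHn.
exists [set x | exists n, x \in L n]; last first.
  move=> x y [m xm] [n yn]; apply: (LG (maxn m n)) => /=.
    exact: Lmono (leq_maxl _ _) xm.
  exact: Lmono (leq_maxr _ _) yn.
move=> U U0 oU; have [z [Ua /Aa[i _ ai]]] := dA U U0 oU; rewrite -ai in Ua.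
have [r r0 rU] := open_rnormP oU Ua.
(* This gives 1/(k+1) < r, so the point chosen at the stage encoding [(i, k)] falls into [U]. *)
pose k := Num.truncn r^-1.
exists (f (pickle (i, k), L (pickle (i, k)))); split; last first.
  by exists (pickle (i, k)).+1; rewrite /= mem_head.
apply: rU; have [+ _] := fP (pickle (i, k), L (pickle (i, k))).
rewrite /= pickleK => /lt_trans; apply.
by rewrite invf_plt ?posrE// truncnS_gt.
Qed.

(** Zorn's lemma gives a maximal [S] with [S0 | S] scattered; were this union countable, a point
    generic with respect to it could be added. *)
Lemma dense_uncountable_scattered : separable X ->
  exists S : set X, [/\ ~ countable S, dense S & scattered S].
Proof.
move=> /dense_scattered[S0 dS0 S0G].
have [|S [SG Smax]] := @Zorn_bigcup X [set S | scattered (S0 `|` S)].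
  move=> C CG Ctot x y /= [S0x|[B CB Bx]] [S0y|[B' CB' By]].
  (* The chain may be empty, so two points of [S0] are handled by the choice of [S0] itself. *)
  - exact: S0G.
  - by apply: (CG _ CB'); [left|right].
  - by apply: (CG _ CB); [right|left].
  - have [BB'|B'B] := Ctot _ _ CB CB'.
      by apply: (CG _ CB'); right => //; exact: BB'.
    by apply: (CG _ CB); right => //; exact: B'B.
exists (S0 `|` S); split => //; last first.
  by move=> U U0 oU; have [x [Ux S0x]] := dS0 U U0 oU; exists x; split => //; left.
move=> cS; have [|x _ xG] := generic_avoiding cS (@openT X); first by exists 0.
(* The new point is really new because 0 is not in [G]. *)
have xS : ~ S x by move=> Sx; apply: G0; rewrite -(subrr x); apply: xG; right.
apply: (Smax (x |` S)).
  by split => [y Sy|SxS]; [right|apply: xS; apply: SxS; left].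
move=> y z; rewrite setUCA => -[->|Sy] [->|Sz] yz //.
- exact: xG.
- by apply: G_sym; exact: xG.
- exact: SG.
Qed.

End DifferenceSet.

(** * Cesaro means *)

Section Cesaro.
Variable R : realType.
Implicit Types (a b : nat -> R) (N : nat).

Lemma cesaro_ge0 a N : (forall j, 0 <= a j) -> 0 <= cesaro a N.
Proof. by move=> a0; rewrite mulr_ge0 ?invr_ge0// sumr_ge0. Qed.

(** The sums start at 1, so a comparison at positive indices suffices; the norm estimate on the
    iterates is available only there. *)
Lemma ler_cesaro a b N : (forall j, (0 < j)%N -> a j <= b j) ->
  cesaro a N <= cesaro b N.
Proof.
move=> ab; rewrite /cesaro ler_wpM2l ?invr_ge0//.
by rewrite !big_nat; apply: ler_sum => j /andP[/ab].
Qed.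

Lemma cesaroD a b N : cesaro (fun j => a j + b j) N = cesaro a N + cesaro b N.
Proof. by rewrite /cesaro big_split mulrDr. Qed.

Lemma cesaroZ (c : R) a N : cesaro (fun j => c * a j) N = c * cesaro a N.
Proof. by rewrite /cesaro -mulr_sumr mulrCA. Qed.

End Cesaro.

(** * Lower and upper limits from frequently small or large terms *)

Section Limits.
Variables (R : realType) (u : nat -> R).

Lemma limn_einf_eq0 : (forall n, 0 <= u n) ->
  (forall n, exists2 N, (n <= N)%N & u N < n.+1%:R^-1) ->
  limn_einf (fun n => (u n)%:E) = 0%E.
Proof.
move=> u0 usmall; rewrite limn_einf_lim; apply: cvg_lim => //.
rewrite (_ : einfs _ = fun=> 0%E); first exact: cvg_cst.
apply/funext => n; apply/eqP; rewrite eq_le; apply/andP; split; last first.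
  by apply: le_ereal_inf_tmp => _ [k _ <-]; rewrite lee_fin.
apply/lee_addgt0Pr => e e0; rewrite add0e.
(* The maximum places [N] in the tail from [n] and also makes the bound on [u N] at most [e]. *)
have [N] := usmall (maxn n (Num.truncn e^-1)); rewrite geq_max => /andP[nN _] uN.
apply: (@le_trans _ _ (u N)%:E); first by apply: ereal_inf_lbound; exists N.
rewrite lee_fin (le_trans (ltW uN))// invf_ple ?posrE//.
by rewrite (le_trans (ltW (truncnS_gt _)))// ler_nat ltnS leq_maxr.
Qed.

Lemma limn_esup_gt0 : (forall n, exists2 N, (n <= N)%N & 1 < u N) ->
  (0 < limn_esup (fun n => (u n)%:E))%E.
Proof.
move=> ularge; apply: (@lt_le_trans _ _ 1%:E); first by rewrite lte_fin.
rewrite limn_esup_lim; apply: lime_ge; first exact: is_cvg_esups.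
apply: nearW => n; have [N nN uN] := ularge n.
apply: (@le_trans _ _ (u N)%:E); first by rewrite lee_fin ltW.
by apply: ereal_sup_ubound; exists N.
Qed.

End Limits.

(** * Orbit means and a criterion for dense mean Li-Yorke chaos *)

Section MeanLiYorke.
Variables (R : realType) (X : completeNormedModType R[i]) (T : X -> X).
Hypothesis T_bounded : bounded_operator T.

Definition orbit_mean (N : nat) (x : X) : R :=
  cesaro (fun j => rnorm (iter j T x)) N.

Lemma iter_linear j : linear (iter j T).
Proof. by elim: j => [|j IHj] a x y //=; rewrite IHj T_bounded.1. Qed.

Lemma iterB j x y : iter j T (x - y) = iter j T x - iter j T y.
Proof. by rewrite addrC -scaleN1r iter_linear scaleN1r addrC. Qed.

Lemma orbit_mean_ge0 N x : 0 <= orbit_mean N x.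
Proof. by apply: cesaro_ge0 => j; exact: rnorm_ge0. Qed.

Lemma orbit_meanN N x : orbit_mean N (- x) = orbit_mean N x.
Proof.
congr cesaro; apply/funext => j.
by rewrite -[- x]sub0r -[x in RHS]subr0 !iterB -rnormN opprB.
Qed.

Lemma orbit_meanD N x y : orbit_mean N (x + y) <= orbit_mean N x + orbit_mean N y.
Proof.
rewrite /orbit_mean -cesaroD; apply: ler_cesaro => j _.
by rewrite -[x]scale1r iter_linear !scale1r rnormD.
Qed.

Lemma orbit_meanZ N (c : R) x : 0 <= c ->
  orbit_mean N (c%:C%C *: x) = c * orbit_mean N x.
Proof.
move=> c0; rewrite /orbit_mean -cesaroZ; congr cesaro; apply/funext => j.
have T0 : iter j T 0 = 0 by rewrite -[X in iter j T X](subrr 0) iterB subrr.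
by rewrite -[_ *: x]addr0 iter_linear T0 addr0 rnormZ.
Qed.

Lemma orbit_mean_bounded N :
  exists2 L, 0 <= L & forall x, orbit_mean N x <= L * rnorm x.
Proof.
(* [M] carries no sign; its truncation at 0 makes the induction for [M' ^+ j] work. *)
have [_ [M TM]] := T_bounded; pose M' := Num.max M 0.
have M'0 : 0 <= M' by rewrite le_max lexx orbT.
exists (cesaro (fun j => M' ^+ j) N).
  by apply: cesaro_ge0 => j; exact: exprn_ge0.
move=> x; rewrite mulrC -cesaroZ; apply: ler_cesaro => j _.
elim: j => [|j IHj]; first by rewrite expr0 mulr1.
rewrite exprS mulrCA (le_trans (TM _))// (@le_trans _ _ (M' * rnorm (iter j T x)))//.
  by rewrite ler_wpM2r ?rnorm_ge0// le_max lexx.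
by rewrite ler_wpM2l.
Qed.

Lemma orbit_mean_nbhs N x (e : R) : 0 < e ->
  exists2 r, 0 < r & forall y, rnorm (y - x) < r -> orbit_mean N (y - x) < e.
Proof.
move=> e0; have [L L0 mL] := orbit_mean_bounded N.
have L10 : 0 < L + 1 by rewrite ltr_wpDl.
exists (e / (L + 1)); first by rewrite divr_gt0.
move=> y; rewrite ltr_pdivlMr// => ye.
rewrite (le_lt_trans (mL _))// (le_lt_trans _ ye)// mulrC.
by rewrite ler_wpM2l ?rnorm_ge0// lerDl.
Qed.

Lemma open_orbit_mean_lt N (c : R) : open [set x | orbit_mean N x < c].
Proof.
rewrite openE => x /= xc; apply/nbhs_rnormP.
have /(orbit_mean_nbhs N x)[r r0 rP] : 0 < c - orbit_mean N x by rewrite subr_gt0.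
exists r => // y /rP; rewrite ltrBrDr; apply: le_lt_trans.
by rewrite -{1}(subrK x y) orbit_meanD.
Qed.

Lemma open_orbit_mean_gt N (c : R) : open [set x | c < orbit_mean N x].
Proof.
rewrite openE => x /= xc; apply/nbhs_rnormP.
have /(orbit_mean_nbhs N x)[r r0 rP] : 0 < orbit_mean N x - c by rewrite subr_gt0.
exists r => // y /rP; rewrite -orbit_meanN opprB ltrBrDr addrC -ltrBrDr.
by move/lt_le_trans; apply; rewrite lerBlDr -{1}(subrK y x) addrC orbit_meanD.
Qed.

(** The intersection over all [n] is the set of points whose orbit means have lower limit 0. *)
Definition small_mean n := \bigcup_(N in [set N | (n <= N)%N])
  [set x | orbit_mean N x < n.+1%:R^-1].

(** The intersection over all [n] consists of the points whose orbit mean exceeds 1 infinitely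
    often. *)
Definition large_mean n := \bigcup_(N in [set N | (n <= N)%N])
  [set x | 1 < orbit_mean N x].

Lemma dense_small_mean (D : set X) (Nk : nat -> nat) :
  (forall k, (k <= Nk k)%N) -> dense D ->
  (forall x, D x -> orbit_mean (Nk k) x @[k --> \oo] --> (0 : R)) ->
  forall n, dense (small_mean n).
Proof.
move=> Nkk dD D0 n U U0 oU; have [x [Ux Dx]] := dD U U0 oU.
exists x; split => //.
have n0 : (0 : R) < n.+1%:R^-1 by rewrite invr_gt0.
have /cvgr0_norm_lt/(_ _ n0)[k0 _ k0P] := D0 x Dx.
have := k0P _ (leq_maxr n k0); set k := maxn n k0 => xk.
exists (Nk k) => /=; first by rewrite (leq_trans _ (Nkk k))// leq_maxl.
by rewrite (le_lt_trans _ xk)// ler_norm.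
Qed.

(** The means of index below [n] are bounded by their sum [s], so a mean above [Num.max c 0 + s] has
    index at least [n]. *)
Lemma unbounded_mean_frequently (e : X) :
  (forall c, exists N, c < orbit_mean N e) ->
  forall c n, exists2 N, (n <= N)%N & c < orbit_mean N e.
Proof.
move=> eP c n; pose s := \sum_(i < n) orbit_mean i e.
have s0 : 0 <= s by apply: sumr_ge0 => i _; exact: orbit_mean_ge0.
have [N] := eP (Num.max c 0 + s); have [nN|Nn] := leqP n N => cN.
  exists N => //; apply: le_lt_trans cN.
  by rewrite (@le_trans _ _ (Num.max c 0)) ?lerDl// le_max lexx.
exfalso; move: cN; apply/negP; rewrite -leNgt.
rewrite (@le_trans _ _ s)//; last by rewrite lerDr le_max lexx orbT.
rewrite /s (bigD1 (Ordinal Nn))//= lerDl.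
by apply: sumr_ge0 => i _; exact: orbit_mean_ge0.
Qed.

Lemma dense_large_mean (e : X) :
  (forall c, exists N, c < orbit_mean N e) -> forall n, dense (large_mean n).
Proof.
move=> /unbounded_mean_frequently eP n U [x Ux] oU.
have [|xsmall] := pselect (large_mean n x); first by exists x.
have [r r0 rU] := open_rnormP oU Ux.
have e10 : 0 < rnorm e + 1 by rewrite ltr_wpDl// rnorm_ge0.
(* The added 1 avoids division by 0 and makes the norm of [d e] strictly less than [r]. *)
pose d := r / (rnorm e + 1); have d0 : 0 < d by rewrite divr_gt0.
(* The mean of [d e] then exceeds 2, and subtracting the mean of [x], at most 1, leaves more than
   1. *)
have [N nN eN] := eP (2 / d) n.
exists (x + d%:C%C *: e); split.
  apply: rU; rewrite addrC addKr rnormZ ?(ltW d0)// /d mulrAC.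
  by rewrite ltr_pdivrMr// ltr_pM2l// ltrDl.
exists N => //=; move: eN; rewrite ltr_pdivrMr// mulrC -orbit_meanZ ?(ltW d0)//.
have xN : orbit_mean N x <= 1.
  by rewrite leNgt; apply/negP => xN; apply: xsmall; exists N.
have := orbit_meanD N (x + d%:C%C *: e) (- x).
rewrite [x + _]addrC addrK orbit_meanN; lra.
Qed.

Lemma mean_Li_Yorke_criterion (D : set X) (Nk : nat -> nat) (e : X) :
  separable X -> (forall k, (k <= Nk k)%N) -> dense D ->
  (forall x, D x -> orbit_mean (Nk k) x @[k --> \oo] --> (0 : R)) ->
  (forall c, exists N, c < orbit_mean N e) ->
  densely_mean_Li_Yorke_chaotic T.
Proof.
move=> sepX Nkk dD D0 eP; split => //.
have small_open n : open (small_mean n).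
  by apply: bigcup_open => N _; exact: open_orbit_mean_lt.
have large_open n : open (large_mean n).
  by apply: bigcup_open => N _; exact: open_orbit_mean_gt.
pose F n := small_mean n `&` large_mean n.
have [| | | |S [cS dS SF]] := @dense_uncountable_scattered _ _ F _ _ _ _ sepX.
- by move=> n; exact: openI.
- move=> n; apply: denseI => //; first exact: dense_small_mean dD D0 n.
  exact: dense_large_mean eP n.
- move=> n x [[N nN xN] [N' nN' xN']].
  by split; [exists N|exists N'] => //=; rewrite orbit_meanN.
(* All orbit means of 0 vanish, so 0 lies in no [large_mean n]. *)
- move=> /(_ 0%N I)[_ [N _ /=]].
  have := orbit_meanZ N 0 (lexx 0); rewrite scale0r mul0r => ->.
  by rewrite ltr10.
exists S; split => // x y Sx Sy xy m.
have mE N : m N = orbit_mean N (x - y).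
  by congr cesaro; apply/funext => j; rewrite iterB.
have Fxy := SF x y Sx Sy xy.
split.
  apply: limn_einf_eq0 => n; first by rewrite mE orbit_mean_ge0.
  by have [[N nN xyN] _] := Fxy n I; exists N; rewrite ?mE.
apply: limn_esup_gt0 => n.
by have [_ [N nN xyN]] := Fxy n I; exists N; rewrite ?mE.
Qed.

End MeanLiYorke.

(** * The function space and orbits of the weighted composition operator *)

Section FunctionSpace.
Variables (R : realType) (X : completeNormedModType R[i]).
Variable fn : X -> R[i]^o -> R[i]^o.
Hypothesis X_functions : analytic_function_space fn.

Lemma elt_unique x f : eq_on_disk (fn x) f -> elt fn f = x.
Proof.
move=> xf; rewrite /elt; case: xgetP => [y _ /= yf|/(_ x)//].
by apply: (fn_inj X_functions) => z Dz; rewrite yf// xf.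
Qed.

Lemma eltP f : in_space fn f -> eq_on_disk (fn (elt fn f)) f.
Proof. by case=> x xf; rewrite (elt_unique xf). Qed.

Lemma Hinfty_cst (c : R[i]^o) : Hinfty (fun=> c).
Proof.
split; first by move=> z _; exact: derivable_cst.
by exists `|c|; split; [exact: normr_real|move=> M /ltW cM z _].
Qed.

(** Identifies the orbit of the constant 1 with the iterated weights, so its orbit means are the
    means in the hypotheses of the theorem. *)
Lemma iter_wcomp_op1 (w phi : R[i]^o -> R[i]^o) j :
  analytic_self_map phi -> in_space fn (fun=> 1) -> wcomp_bounded fn w phi ->
  iter j (wcomp_op fn w phi) (elt fn (fun=> 1)) = elt fn (weight_iter w phi j).
Proof.
move=> [_ phiD] fn1 [wfn _]; apply/esym/elt_unique; elim: j => [|j IHj] z Dz.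
  by rewrite /= eltP// /weight_iter big_geq.
rewrite /= eltP// /wcomp IHj; last exact: phiD.
(* The factor of index 0 is [w z]; the others form the previous product evaluated at [phi z]. *)
rewrite /weight_iter big_nat_recl//=; congr (_ * _).
by apply: eq_bigr => k _; rewrite -iterSr.
Qed.

End FunctionSpace.

Theorem corollary2 (R : realType) (X : completeNormedModType R[i])
    (fn : X -> R[i]^o -> R[i]^o)
    (X_functions : analytic_function_space fn)
    (X_infinite_dimensional : infinite_dimensional X)
    (X_separable : separable X)
    (Hinfty_sub : forall f : R[i]^o -> R[i]^o, Hinfty f -> in_space fn f)
    (Hinfty_dense : dense [set x : X | Hinfty (fn x)])
    (wcomp_bound : forall psi u : R[i]^o -> R[i]^o,
        analytic_self_map psi -> Hinfty u ->
        wcomp_bounded fn u psi /\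
        (forall (f : R[i]^o -> R[i]^o) (n : nat), Hinfty f -> (0 < n)%N ->
           rnorm (iter n (wcomp_op fn u psi) (elt fn f)) <=
             space_norm fn (weight_iter u psi n) * Hinfty_norm f))
    (phi w : R[i]^o -> R[i]^o)
    (phi_self_map : analytic_self_map phi) (w_Hinfty : Hinfty w)
    (Nk : nat -> nat)
    (Nk_pos : forall k, (0 < Nk k)%N)
    (Nk_increasing : forall k, (Nk k < Nk k.+1)%N)
    (mean_to_0 :
       cesaro (fun j => space_norm fn (weight_iter w phi j)) (Nk k)
         @[k --> \oo] --> (0 : R))
    (mean_unbounded :
       ereal_sup
         [set (cesaro (fun j => space_norm fn (weight_iter w phi j)) N)%:E
            | N in [set N | (0 < N)%N]] = +oo%E) :
  densely_mean_Li_Yorke_chaotic (wcomp_op fn w phi).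
Proof.
have [T_bdd T_bound] := wcomp_bound phi w phi_self_map w_Hinfty.
have Nk_ge k : (k <= Nk k)%N by elim: k => [//|k IHk]; exact: leq_ltn_trans IHk _.
apply: (mean_Li_Yorke_criterion T_bdd.2 (e := elt fn (fun=> 1)) X_separable Nk_ge
  Hinfty_dense).
(* For bounded [fn x], the orbit means along [Nk] are squeezed between 0 and [c] times the means of
   the weight norms. *)
- move=> x Hx; set c := Hinfty_norm (fn x).
  apply: (@squeeze_cvgr _ _ _ _ (fun=> 0)
    (fun k => c * cesaro (fun j => space_norm fn (weight_iter w phi j)) (Nk k))).
  + apply: nearW => k; rewrite orbit_mean_ge0 -cesaroZ; apply: ler_cesaro => j j0.
    have -> : x = elt fn (fn x) by apply/esym/elt_unique.
    by rewrite mulrC; exact: T_bound.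
  + exact: cvg_cst.
  + by rewrite -(mulr0 c); apply: cvgMr.
(* The infinite supremum supplies a mean above any given [c], and this is an orbit mean of the
   constant 1. *)
- move=> c; have : (c%:E < +oo)%E by rewrite ltry.
  rewrite -mean_unbounded => /ereal_sup_gt[_ [N _ <-]]; rewrite lte_fin => cN.
  exists N; rewrite (lt_le_trans cN)// /orbit_mean.
  rewrite le_eqVlt; apply/orP; left; apply/eqP; congr cesaro; apply/funext => j.
  rewrite (iter_wcomp_op1 X_functions _ phi_self_map _ T_bdd)//.
  exact/Hinfty_sub/Hinfty_cst.
Qed.
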